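(* Let $d\ge 2$, let $X\in\mathbb R^{n_1\times\cdots\times n_d}$, let $r_0=r_d=1$, and let $r_1,\dots,r_{d-1}$ be positive integers (the prescribed TT ranks). (i) Let $G_1,\dots,G_d$ be the TT cores and $\mathcal I_p=\{(i_1^{(\alpha_p)},\dots,i_p^{(\alpha_p)})\}_{\alpha_p=1}^{r_p}$, $p=1,\dots,d-1$, the left index sets produced by a forward (left-to-right) TT-CROSS-DEIM sweep applied to $X$, with arbitrary given right index sets $\mathcal J_1,\dots,\mathcal J_{d-1}$. Then for every $p=1,\dots,d-1$ the $r_p\times r_p$ matrix $\mathbf G_{1\rightarrow p}$ whose $\alpha_p$-th row is $$\mathbf g_{1\rightarrow p}^{(\alpha_p)}=G_1(1,i_1^{(\alpha_p)},:)\,G_2(:,i_2^{(\alpha_p)},:)\cdots G_p(:,i_p^{(\alpha_p)},:)\in\mathbb R^{1\times r_p}$$ satisfies $\mathbf G_{1\rightarrow p}=\mathbf I_{r_p}$. (ii) Let $G_1,\dots,G_d$ be the TT cores and $\mathcal J_p=\{(i_{p+1}^{(\alpha_p)},\dots,i_d^{(\alpha_p)})\}_{\alpha_p=1}^{r_p}$, $p=1,\dots,d-1$, the right index sets produced by a reverse (right-to-left) TT-CROSS-DEIM sweep applied to $X$, with arbitrary given left index sets $\mathcal I_1,\dots,\mathcal I_{d-1}$. Then for every $p=1,\dots,d-1$ the $r_p\times r_p$ matrix $\mathbf G_{p+1\rightarrow d}$ whose $\alpha_p$-th column is $$\mathbf g_{p+1\rightarrow d}^{(\alpha_p)}=G_{p+1}(:,i_{p+1}^{(\alpha_p)},:)\cdots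 G_d(:,i_d^{(\alpha_p)},1)\in\mathbb R^{r_p\times 1}$$ satisfies $\mathbf G_{p+1\rightarrow d}=\mathbf I_{r_p}$.
   Context: TT cores are arrays $G_p\in\mathbb R^{r_{p-1}\times n_p\times r_p}$. For fixed $i_p$, $G_p(:,i_p,:)$ is an $r_{p-1}\times r_p$ matrix, $G_1(1,i_1,:)$ is a $1\times r_1$ row vector, and $G_d(:,i_d,1)$ is an $r_{d-1}\times 1$ column vector. $\mathbf I_r$ is the $r\times r$ identity matrix. All index sets are ordered lists. DEIM: given $\mathbf U=[u_1,\dots,u_r]\in\mathbb R^{m\times r}$ with linearly independent columns ($r\le m$), the discrete empirical interpolation method returns an ordered list of $r$ distinct row indices as follows. The first index is a position of the entry of $u_1$ of largest absolute value. Given the list $\mathcal I'$ of the first $j-1$ indices, the $j$-th index is a position of the entry of largest absolute value of $u_j-[u_1,\dots,u_{j-1}]c$, where $c$ solves $[u_1,\dots,u_{j-1}](\mathcal I',:)\,c=u_j(\mathcal I')$. The resulting list $\mathcal I=\mathrm{DEIM}(\mathbf U)$ is such that $\mathbf U(\mathcal I,:)\in\mathbb R^{r\times r}$ (rows of $\mathbf U$ selected in the order of $\mathcal I$) is invertible. Forward TT-CROSS-DEIM sweep. The ranks satisfy $r_p\le r_{p-1}n_p$ for $p=1,\dots,d-1$. The input consists of lists $\mathcal J_p$ of $r_p$ tuples $(j_{p+1}^{(\beta)},\dots,j_d^{(\beta)})$, $\beta=1,\dots,r_p$, of indices of modes $p+1,\dots,d$. For $p=1,\dots,d-1$ in turn,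 form the matrix $\mathbf S_p\in\mathbb R^{r_{p-1}n_p\times r_p}$ with rows indexed by pairs $(\alpha_{p-1},i_p)$ and entries $$\mathbf S_p\big((\alpha_{p-1},i_p),\beta\big)=X\big(i_1^{(\alpha_{p-1})},\dots,i_{p-1}^{(\alpha_{p-1})},i_p,j_{p+1}^{(\beta)},\dots,j_d^{(\beta)}\big),$$ where $(i_1^{(\alpha_{p-1})},\dots,i_{p-1}^{(\alpha_{p-1})})$ is the $\alpha_{p-1}$-th element of $\mathcal I_{p-1}$ (for $p=1$ the rows are indexed by $i_1$ alone). Let $\mathbf U_p\in\mathbb R^{r_{p-1}n_p\times r_p}$ be a matrix of $r_p$ (orthonormal) left singular vectors of $\mathbf S_p$, corresponding to its largest singular values. Let $\mathcal I_p=\mathrm{DEIM}(\mathbf U_p)$, an ordered list of $r_p$ row indices, and set $\mathbf G_p=\mathbf U_p\,\mathbf U_p(\mathcal I_p,:)^{-1}\in\mathbb R^{r_{p-1}n_p\times r_p}$. The core $G_p$ is the reshaping $G_p(\alpha_{p-1},i_p,\alpha_p)=\mathbf G_p((\alpha_{p-1},i_p),\alpha_p)$. Each selected row index $(\alpha_{p-1}^{(\alpha_p)},i_p^{(\alpha_p)})$ is identified with the $p$-tuple obtained by appending $i_p^{(\alpha_p)}$ to the $\alpha_{p-1}^{(\alpha_p)}$-th element of $\mathcal I_{p-1}$, so that $\mathcal I_p$ is also regarded as a list of $p$-tuples $(i_1^{(\alpha_p)},\dots,i_p^{(\alpha_p)})$ and the left index sets are nested. The last core is $G_d(\alpha_{d-1},i_d,1)=X(i_1^{(\alpha_{d-1})},\dots,i_{d-1}^{(\alpha_{d-1})},i_d)$.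 Reverse TT-CROSS-DEIM sweep. This is the same procedure with the order of the tensor modes reversed (ranks satisfying $r_{p-1}\le n_p r_p$ for $p=2,\dots,d$). The input consists of lists $\mathcal I_p$ of $r_p$ tuples of indices of modes $1,\dots,p$. For $p=d,d-1,\dots,2$ in turn, form the matrix with rows indexed by pairs $(i_p,\alpha_p)$ and columns indexed by $\beta=1,\dots,r_{p-1}$, whose entries are those of $X$ with modes $1,\dots,p-1$ fixed to the $\beta$-th element of $\mathcal I_{p-1}$, mode $p$ equal to $i_p$, and modes $p+1,\dots,d$ fixed to the $\alpha_p$-th element of $\mathcal J_p$ (no $\alpha_p$ for $p=d$). Take $r_{p-1}$ left singular vectors $\mathbf U_p$ corresponding to the largest singular values, let $\mathcal J_{p-1}=\mathrm{DEIM}(\mathbf U_p)$, set $\mathbf G_p=\mathbf U_p\mathbf U_p(\mathcal J_{p-1},:)^{-1}$, and let $G_p(\alpha_{p-1},i_p,\alpha_p)=\mathbf G_p((i_p,\alpha_p),\alpha_{p-1})$. Each selected pair is identified with the tuple obtained by prepending its $i_p$ to the corresponding element of $\mathcal J_p$, so the right index sets are nested. The first core is $G_1(1,i_1,\alpha_1)=X(i_1,i_2^{(\alpha_1)},\dots,i_d^{(\alpha_1)})$, with $(i_2^{(\alpha_1)},\dots,i_d^{(\alpha_1)})$ the $\alpha_1$-th element of $\mathcal J_1$. *)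

(* Defs.v *)
From HB Require Import structures.
From mathcomp Require Import all_boot all_order all_algebra.
From mathcomp Require Import reals.

Set Implicit Arguments.
Unset Strict Implicit.
Unset Printing Implicit Defensive.

Import Order.TTheory GRing.Theory Num.Theory.
Local Open Scope ring_scope.

(* Modes, sizes [n], ranks [r] and cores are numbered as in the TT literature:
   modes and cores from 1 to d, ranks from 0 to d.  Values of [n], [r] and of
   families such as [G] outside these ranges are irrelevant. *)

(* Tuples (i_{a+1}, ..., i_b) of indices of the modes a+1, ..., b.  Thus
   [mindex n 0 d -> R] is the type of tensors of size n_1 x ... x n_d, and
   [mindex n a a] contains only the empty tuple. *)
Definition mindex (n : nat -> nat) (a b : nat) : Type :=
  forall k : nat, (a < k <= b)%N -> 'I_(n k).

Lemma mode_split (a b c k : nat) :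
  (a < k <= c)%N -> {(a < k <= b)%N} + {(b < k <= c)%N}.
Proof.
case: (leqP k b) => [kb|bk] /andP[ak kc]; first by left; rewrite ak.
by right; rewrite kc.
Qed.

Lemma mode_eq (p k : nat) : (p.-1 < k <= p)%N -> p = k.
Proof.
case: p => [|p] /= /andP[lt_k le_k]; first by case: k lt_k le_k.
by apply/eqP; rewrite eqn_leq lt_k le_k.
Qed.

Lemma mode_widen (a b k : nat) : (a < k <= b)%N -> (a < k <= b.+1)%N.
Proof. by case/andP=> -> /leqW ->. Qed.

Lemma mode_last (a b : nat) : (a <= b)%N -> (a < b.+1 <= b.+1)%N.
Proof. by rewrite ltnS leqnn andbT. Qed.

Definition mcat (n : nat -> nat) (a b c : nat)
    (x : mindex n a b) (y : mindex n b c) : mindex n a c :=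
  fun k h => match mode_split b h with
             | left hx => x k hx
             | right hy => y k hy
             end.

Definition msingle (n : nat -> nat) (p : nat) (i : 'I_(n p)) :
    mindex n p.-1 p :=
  fun k h => cast_ord (congr1 n (mode_eq h)) i.

(* [G p i] is the slice G_p(:, i, :). *)
Definition ttcores (R : Type) (n r : nat -> nat) : Type :=
  forall p : nat, 'I_(n p) -> 'M[R]_(r p.-1, r p).

(* [ttprod G t] is G_{a+1}(:, i_{a+1}, :) ... G_b(:, i_b, :) for
   t = (i_{a+1}, ..., i_b).  The empty product (a = b) is the identity, which
   is written [pid_mx (r a)] because its type is 'M_(r a, r b). *)
Fixpoint ttprod (R : realType) (n r : nat -> nat) (G : ttcores R n r)
    (a b : nat) : mindex n a b -> 'M[R]_(r a, r b) :=
  match b return mindex n a b -> 'M[R]_(r a, r b) with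
  | 0 => fun _ => pid_mx (r a)
  | b'.+1 => fun t =>
      match boolP (a <= b')%N with
      | AltTrue h =>
          ttprod G (fun k hk => t k (mode_widen hk))
          *m G b'.+1 (t b'.+1 (mode_last h))
      | AltFalse _ => pid_mx (r a)
      end
  end.

(* The columns of [U] are [k] distinct left singular vectors from a reduced
   singular value decomposition S = W diag(s) V^T, whose singular values are
   no smaller than the remaining ones.  No order among the chosen columns is
   imposed, so the usual nonincreasing order is a particular case. *)
Definition leading_left_singular_vectors (R : realType) (m q k : nat)
    (S : 'M[R]_(m, q)) (U : 'M[R]_(m, k)) : Prop :=
  exists (W : 'M[R]_(m, minn m q)) (s : 'rV[R]_(minn m q))
         (V : 'M[R]_(q, minn m q)) (f : 'I_k -> 'I_(minn m q)),
    [/\ [/\ W^T *m W = 1%:M, V^T *m V = 1%:M, forall a, 0 <= s 0 a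
          & S = W *m diag_mx s *m V^T],
        injective f,
        forall a b, b \notin codom f -> s 0 b <= s 0 (f a)
      & U = colsub f W].

(* [DEIM U I]: [I] is a possible output of DEIM on [U] (ties between entries of
   largest absolute value are broken arbitrarily).  For the first index, [j] is
   0, [c] is the empty vector and the residual is the first column of [U]. *)
Definition DEIM (R : realType) (m r : nat) (U : 'M[R]_(m, r))
    (I : 'I_r -> 'I_m) : Prop :=
  forall j : 'I_r,
    let prev : 'I_j -> 'I_r := widen_ord (ltnW (ltn_ord j)) in
    exists c : 'cV[R]_j,
      mxsub (I \o prev) prev U *m c = rowsub (I \o prev) (col j U) /\
      let res := col j U - colsub prev U *m c in
      forall i : 'I_m, `|res i 0| <= `|res (I j) 0|.

(* U U(I, :)^{-1} *)
Definition interp_basis (R : realType) (m r : nat) (U : 'M[R]_(m, r))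
    (I : 'I_r -> 'I_m) : 'M[R]_(m, r) :=
  U *m invmx (rowsub I U).

(* The index sets are ordered lists, [I p a] being the a-th element of I_p.
   The only possible I_0 (when r_0 = 1) is the list of the empty tuple, so that
   at the first step rows are indexed by i_1 alone.  A pair of row indices
   (alpha, i) is encoded as [mxvec_index alpha i], and the step below treats
   mode p+1. *)
Definition forward_sweep (R : realType) (d : nat) (n r : nat -> nat)
    (X : mindex n 0 d -> R)
    (J : forall p : nat, 'I_(r p) -> mindex n p d)
    (I : forall p : nat, 'I_(r p) -> mindex n 0 p)
    (G : ttcores R n r) : Prop :=
  (forall p : nat, (p.+1 < d)%N ->
     let S : 'M[R]_(r p * n p.+1, r p.+1) :=
       (\matrix_(b < r p.+1) mxvec (\matrix_(a < r p, i < n p.+1)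
          X (mcat (mcat (I p a) (msingle i)) (J p.+1 b))))^T in
     exists (U : 'M[R]_(r p * n p.+1, r p.+1))
            (sel : 'I_(r p.+1) -> 'I_(r p) * 'I_(n p.+1)),
       let row_of a := mxvec_index (sel a).1 (sel a).2 in
       [/\ leading_left_singular_vectors S U,
           DEIM U row_of,
           forall a, I p.+1 a = mcat (I p (sel a).1) (msingle (sel a).2)
         & forall i, G p.+1 i = \matrix_(a < r p, b < r p.+1)
             interp_basis U row_of (mxvec_index a i) b]) /\
  (forall (a : 'I_(r d.-1)) (i : 'I_(n d)) (b : 'I_(r d)),
     G d i a b = X (mcat (I d.-1 a) (msingle i))).

(* Here the only possible J_d (when r_d = 1) is the list of the empty tuple;
   pairs of row indices are (i, alpha), and the step treats mode p+1. *)
Definition reverse_sweep (R : realType) (d : nat) (n r : nat -> nat)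
    (X : mindex n 0 d -> R)
    (I : forall p : nat, 'I_(r p) -> mindex n 0 p)
    (J : forall p : nat, 'I_(r p) -> mindex n p d)
    (G : ttcores R n r) : Prop :=
  (forall p : nat, (0 < p < d)%N ->
     let S : 'M[R]_(n p.+1 * r p.+1, r p) :=
       (\matrix_(b < r p) mxvec (\matrix_(i < n p.+1, a < r p.+1)
          X (mcat (mcat (I p b) (msingle i)) (J p.+1 a))))^T in
     exists (U : 'M[R]_(n p.+1 * r p.+1, r p))
            (sel : 'I_(r p) -> 'I_(n p.+1) * 'I_(r p.+1)),
       let row_of b := mxvec_index (sel b).1 (sel b).2 in
       [/\ leading_left_singular_vectors S U,
           DEIM U row_of,
           forall b, J p b = mcat (msingle (sel b).1) (J p.+1 (sel b).2)
         & forall i, G p.+1 i = \matrix_(b < r p, a < r p.+1)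
             interp_basis U row_of (mxvec_index i a) b]) /\
  (forall (i : 'I_(n 1%N)) (a0 : 'I_(r 0%N)) (a : 'I_(r 1%N)),
     G 1%N i a0 a = X (mcat (msingle i) (J 1%N a))).

(* Main.v *)
Require Import Defs.
From mathcomp Require Import all_boot all_order all_algebra.
From mathcomp Require Import reals.

(** Both parts rest on two facts.

    Interpolation: the DEIM rows of a matrix [U] with independent columns form
    an invertible submatrix ([DEIM_unitmx]), so the selected rows of
    [interp_basis U I], which is U U(I,:)^{-1}, are the rows of the identity
    matrix ([interp_basis_selected]).  Leading left singular vectors are
    orthonormal, hence independent.

    Nestedness: the a-th tuple of the p-th left index set is a tuple of the
    previous set, the s(a)-th say, followed by one index i.  Its product of
    slices is therefore the product attached to s(a), times G_p(:, i, :)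
    ([ttprod_mcat], [ttprod_msingle]).  By induction the first factor is the
    s(a)-th row of the identity, so the product is the s(a)-th row of the slice
    G_p(:, i, :); this is the row (s(a), i) of U U(I,:)^{-1}, that is, the a-th
    selected row, which is the a-th row of the identity.  The reverse sweep is
    symmetric: the product attached to the remaining modes is a column of the
    identity, and the induction runs downwards from mode d.  In both directions
    the induction starts from the empty product, the 1 x 1 identity. *)

Set Implicit Arguments.
Unset Strict Implicit.
Unset Printing Implicit Defensive.

Import Order.TTheory GRing.Theory Num.Theory.
Local Open Scope ring_scope.

(** * Products of slices along concatenated tuples *)

(** Tuples are functions that also take proofs of the bounds, so the same
    tuple may be presented by different terms; this lets them be exchanged
    without functional extensionality. *)
Lemma eq_ttprod (R : realType) (n r : nat -> nat) (G : ttcores R n r)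
    (a b : nat) (x y : mindex n a b) :
  (forall k h, x k h = y k h) -> ttprod G x = ttprod G y.
Proof.
elim: b x y => [|b IHb] x y eq_xy //=.
(* Only the index of the [boolP] family may be generalized: the branches use
   the proof that they bind as a proof of the inequality itself. *)
move: (boolP _); generalize (a <= b)%N at 3 => c [leab|//].
by rewrite eq_xy; congr (_ *m _); apply: IHb => k h; apply: eq_xy.
Qed.

Lemma ttprod_nil (R : realType) (n r : nat -> nat) (G : ttcores R n r)
    (a : nat) (x : mindex n a a) : ttprod G x = 1%:M.
Proof.
case: a x => [|a] x /=; first by rewrite pid_mx_1.
move: (boolP _); generalize (a < a)%N at 3 => c [ltaa|_].
  by have := ltaa; rewrite ltnn.
by rewrite pid_mx_1.
Qed.

Lemma ttprod_recr (R : realType) (n r : nat -> nat) (G : ttcores R n r)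
    (a b : nat) (x : mindex n a b.+1) (leab : (a <= b)%N) :
  ttprod G x = ttprod G (fun k h => x k (mode_widen h))
               *m G b.+1 (x b.+1 (mode_last leab)).
Proof.
rewrite /=; move: (boolP _); generalize (a <= b)%N at 3 => c [leab'|/negP//].
by rewrite (bool_irrelevance leab' leab).
Qed.

Lemma mcat_left (n : nat -> nat) (a b c k : nat) (x : mindex n a b)
    (y : mindex n b c) (h : (a < k <= c)%N) (hx : (a < k <= b)%N) :
  mcat x y h = x k hx.
Proof.
rewrite /mcat; case: (mode_split b h) => [hx'|hy'].
  by rewrite (bool_irrelevance hx' hx).
by exfalso; case/andP: hx hy' => _ lekb /andP[]; rewrite ltnNge lekb.
Qed.

Lemma mcat_right (n : nat -> nat) (a b c k : nat) (x : mindex n a b)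
    (y : mindex n b c) (h : (a < k <= c)%N) (hy : (b < k <= c)%N) :
  mcat x y h = y k hy.
Proof.
rewrite /mcat; case: (mode_split b h) => [hx'|hy'].
  by exfalso; case/andP: hx' hy => _ lekb /andP[]; rewrite ltnNge lekb.
by rewrite (bool_irrelevance hy' hy).
Qed.

Lemma ttprod_mcat (R : realType) (n r : nat -> nat) (G : ttcores R n r)
    (a b c : nat) (x : mindex n a b) (y : mindex n b c) :
  (a <= b <= c)%N -> ttprod G (mcat x y) = ttprod G x *m ttprod G y.
Proof.
elim: c y => [|c IHc] y /andP[leab lebc].
  (* Here b = 0, and the left-hand tuple is the whole concatenation. *)
  case: b leab lebc x y => // leab _ x y; rewrite ttprod_nil mulmx1.
  by apply: eq_ttprod => k h; apply: mcat_left.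
case: (ltngtP b c.+1) lebc => // [ltbc|eqbc] _; last first.
  case: c.+1 / eqbc y => y; rewrite ttprod_nil mulmx1.
  by apply: eq_ttprod => k h; apply: mcat_left.
have lebc : (b <= c)%N by [].
have leac := leq_trans leab lebc.
rewrite (ttprod_recr G (mcat x y) leac) (ttprod_recr G y lebc).
rewrite (mcat_right x y _ (mode_last lebc)) mulmxA; congr (_ *m _).
rewrite -IHc ?leab //; apply: eq_ttprod => k h.
case/andP: (h) => ltak lekc; case: (leqP k b) => [lekb|ltbk].
  have hx : (a < k <= b)%N by rewrite ltak.
  by rewrite !(mcat_left _ _ _ hx).
have hy : (b < k <= c)%N by rewrite ltbk.
by rewrite (mcat_right _ _ _ hy) (mcat_right _ _ _ (mode_widen hy)).
Qed.

Lemma ttprod_msingle (R : realType) (n r : nat -> nat) (G : ttcores R n r)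
    (p : nat) (i : 'I_(n p.+1)) :
  ttprod G (msingle i : mindex n p p.+1) = G p.+1 i.
Proof.
rewrite (ttprod_recr G _ (leqnn p)) ttprod_nil mul1mx.
by rewrite /msingle cast_ord_id.
Qed.

(** * Invertibility of the rows selected by DEIM *)

(** Adding one column at a time: a vector x on the first k + 1 columns differs
    by x_k y from a vector on the first k columns, where y holds the
    coefficients of the k-th DEIM residual U y.  The residual vanishes at the
    earlier indices and, being nonzero, does not vanish at the new one, where
    its absolute value is largest. *)
Lemma DEIM_leading_kernel (R : realType) (m r : nat) (U : 'M[R]_(m, r))
    (I : 'I_r -> 'I_m) (k : nat) (x : 'cV[R]_r) :
  (forall y : 'cV[R]_r, U *m y = 0 -> y = 0) -> DEIM U I -> (k <= r)%N ->
  (forall a : 'I_r, (k <= a)%N -> x a 0 = 0) ->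
  (forall a : 'I_r, (a < k)%N -> (U *m x) (I a) 0 = 0) ->
  x = 0.
Proof.
move=> injU deimI; elim: k x => [|k IHk] x lekr x0 Ux0.
  by apply/colP=> a; rewrite mxE x0.
pose j : 'I_r := Ordinal lekr.
have [c []] := deimI j.
set prev := widen_ord _ => solc resmax.
pose y : 'cV[R]_r := delta_mx j 0 - colsub prev 1%:M *m c.
have resE : col j U - colsub prev U *m c = U *m y.
  by rewrite mulmxBr -colE mulmxA mulmx_colsub mulmx1.
rewrite /= resE in resmax.
have y_ge (a : 'I_r) : (k <= a)%N -> y a 0 = (a == j)%:R.
  move=> leka; rewrite !mxE eqxx andbT big1 ?subr0 // => b _; rewrite !mxE.
  case: eqP => [eqab|_]; last by rewrite mul0r.
  by have := ltn_ord b; rewrite ltnNge -[nat_of_ord b]/(nat_of_ord (prev b))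
     -eqab leka.
have Uy_prev (a : 'I_r) : (a < k)%N -> (U *m y) (I a) 0 = 0.
  move=> ltak; have aE : a = prev (Ordinal (ltak : (a < j)%N)) by apply: val_inj.
  rewrite -resE aE; have /colP/(_ (Ordinal (ltak : (a < j)%N))) := solc.
  rewrite !mxE => <-; apply/eqP; rewrite subr_eq0; apply/eqP.
  by apply: eq_bigr => b _; rewrite !mxE.
have Uyj : (U *m y) (I j) 0 != 0.
  apply/eqP => Uyj0; have /injU y0 : U *m y = 0.
    apply/colP=> i; rewrite [RHS]mxE; apply/eqP; rewrite -normr_le0.
    by apply: le_trans (resmax i) _; rewrite Uyj0 normr0.
  by have := y_ge j (leqnn k); rewrite y0 mxE eqxx => /eqP; rewrite eq_sym oner_eq0.
have xE : x = x j 0 *: y.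
  apply/eqP; rewrite -subr_eq0; apply/eqP/IHk => [|a leka|a ltak].
  - exact: ltnW.
  - rewrite 3!mxE y_ge //; have [->|neq_aj] := eqVneq a j.
      by rewrite mulr1 subrr.
    by rewrite mulr0 subr0 x0 // ltn_neqAle leka andbT eq_sym.
  - have -> : (U *m (x - x j 0 *: y)) (I a) 0 =
              (U *m x) (I a) 0 - x j 0 * (U *m y) (I a) 0.
      by rewrite mulmxBr -scalemxAr !mxE.
    by rewrite Uy_prev // Ux0 ?mulr0 ?subr0 // ltnW.
have /eqP := Ux0 j (leqnn _); have -> : (U *m x) (I j) 0 =
    x j 0 * (U *m y) (I j) 0 by rewrite [in LHS]xE -scalemxAr !mxE.
rewrite mulf_eq0 (negPf Uyj) orbF => /eqP xj0.
by rewrite xE xj0 scale0r.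
Qed.

Lemma DEIM_unitmx (R : realType) (m r : nat) (U : 'M[R]_(m, r))
    (I : 'I_r -> 'I_m) :
  (forall y : 'cV[R]_r, U *m y = 0 -> y = 0) -> DEIM U I ->
  rowsub I U \in unitmx.
Proof.
move=> injU deimI; rewrite -unitmx_tr -row_free_unit; apply: inj_row_free => v.
move=> /(congr1 trmx); rewrite trmx_mul trmxK trmx0 => UIv.
apply: trmx_inj; rewrite trmx0.
apply: (DEIM_leading_kernel injU deimI (leqnn r)) => a.
  by rewrite leqNgt ltn_ord.
by move=> _; move/colP/(_ a): UIv; rewrite mul_rowsub_mx !mxE.
Qed.

Lemma leading_left_singular_vectors_inj (R : realType) (m q k : nat)
    (S : 'M[R]_(m, q)) (U : 'M[R]_(m, k)) :
  leading_left_singular_vectors S U ->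
  forall y : 'cV[R]_k, U *m y = 0 -> y = 0.
Proof.
move=> [W [s [V [f [[orthW _ _ _] injf _ UE]]]]] y Uy0.
have orthU : U^T *m U = 1%:M.
  rewrite UE; apply/matrixP => a b.
  have /matrixP/(_ (f a) (f b)) := orthW; rewrite !mxE (inj_eq injf) => <-.
  by apply: eq_bigr => i _; rewrite !mxE.
by rewrite -[y]mul1mx -orthU -mulmxA Uy0 mulmx0.
Qed.

Lemma interp_basis_selected (R : realType) (m q r : nat) (S : 'M[R]_(m, q))
    (U : 'M[R]_(m, r)) (I : 'I_r -> 'I_m) (a b : 'I_r) :
  leading_left_singular_vectors S U -> DEIM U I ->
  interp_basis U I (I a) b = (a == b)%:R.
Proof.
move=> /leading_left_singular_vectors_inj injU deimI.
have := mulmxV (DEIM_unitmx injU deimI).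
by rewrite mul_rowsub_mx => /matrixP/(_ a b); rewrite !mxE.
Qed.

(** * The two sweeps *)

Lemma eq_ord_of_size1 (k : nat) (i j : 'I_k) : k = 1%N -> i = j.
Proof. by move=> k1; move: i j; rewrite k1 => i j; rewrite !ord1. Qed.

Lemma mulmx_unit_row (R : realType) (k l m : nat) (A : 'M[R]_(k, l))
    (B : 'M[R]_(l, m)) (i : 'I_k) (e : 'I_l) (j : 'I_m) :
  (forall c, A i c = (e == c)%:R) -> (A *m B) i j = B e j.
Proof.
move=> Ai; rewrite mxE (bigD1 e) //= Ai eqxx mul1r big1 ?addr0 // => c neq_ce.
by rewrite Ai eq_sym (negPf neq_ce) mul0r.
Qed.

Lemma mulmx_unit_col (R : realType) (k l m : nat) (A : 'M[R]_(k, l))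
    (B : 'M[R]_(l, m)) (i : 'I_k) (e : 'I_l) (j : 'I_m) :
  (forall c, B c j = (e == c)%:R) -> (A *m B) i j = A i e.
Proof.
move=> Bj; rewrite mxE (bigD1 e) //= Bj eqxx mulr1 big1 ?addr0 // => c neq_ce.
by rewrite Bj eq_sym (negPf neq_ce) mulr0.
Qed.

(** As r_0 = 1, the row index [a0] has a single value; quantifying over it
    states the claim without casting the row dimension r_0 to 1. *)
Lemma forward_sweep_ttprod (R : realType) (d : nat) (n r : nat -> nat)
    (X : mindex n 0 d -> R) (J : forall p : nat, 'I_(r p) -> mindex n p d)
    (I : forall p : nat, 'I_(r p) -> mindex n 0 p) (G : ttcores R n r)
    (p : nat) (a0 : 'I_(r 0%N)) (a b : 'I_(r p)) :
  r 0%N = 1%N -> forward_sweep X J I G -> (p < d)%N ->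
  ttprod G (I p a) a0 b = (a == b)%:R.
Proof.
move=> r0 [step _]; elim: p a b => [|p IHp] a b ltpd.
  rewrite ttprod_nil mxE.
  by rewrite (eq_ord_of_size1 a0 a r0)
    (eq_ord_of_size1 b a r0) eqxx.
have [U [sel [svdU deimU Iab GE]]] := step p ltpd.
rewrite Iab ttprod_mcat ?leqnSn // ttprod_msingle GE.
rewrite (@mulmx_unit_row _ _ _ _ _ _ _ (sel a).1) => [|c]; last by apply/IHp/ltnW.
by rewrite mxE; apply: interp_basis_selected svdU deimU.
Qed.

Lemma reverse_sweep_ttprod (R : realType) (d : nat) (n r : nat -> nat)
    (X : mindex n 0 d -> R) (I : forall p : nat, 'I_(r p) -> mindex n 0 p)
    (J : forall p : nat, 'I_(r p) -> mindex n p d) (G : ttcores R n r)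
    (p : nat) (b0 : 'I_(r d)) (a b : 'I_(r p)) :
  r d = 1%N -> reverse_sweep X I J G -> (0 < p <= d)%N ->
  ttprod G (J p a) b b0 = (a == b)%:R.
Proof.
move=> rd [step _] /andP[p_gt0 lepd].
have [k dE] : exists k, (p + k)%N = d by exists (d - p)%N; apply: subnKC.
elim: k p p_gt0 lepd a b dE => [|k IHk] p p_gt0 lepd a b dE.
  rewrite addn0 in dE; case: d / dE X I J b0 rd step lepd => X I J b0 rp _ _.
  rewrite ttprod_nil mxE.
  by rewrite (eq_ord_of_size1 b0 a rp) (eq_ord_of_size1 b a rp) eqxx.
have ltpd : (p < d)%N by rewrite -dE -addSnnS leq_addr.
have pd : (0 < p < d)%N by rewrite p_gt0.
have [U [sel [svdU deimU Jab GE]]] := step p pd.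
rewrite Jab (ttprod_mcat G (@msingle n p.+1 _ : mindex n p p.+1)) ?leqnSn //.
rewrite ttprod_msingle GE (@mulmx_unit_col _ _ _ _ _ _ _ (sel a).2) => [|c].
  by rewrite mxE; apply: interp_basis_selected svdU deimU.
by apply: IHk; rewrite ?addSnnS.
Qed.

Theorem proposition2p1 (R : realType) (d : nat) (n r : nat -> nat)
    (X : mindex n 0 d -> R)
    (hd : (2 <= d)%N) (r0 : r 0%N = 1%N) (rd : r d = 1%N)
    (rpos : forall p : nat, (0 < p < d)%N -> (0 < r p)%N) :
  ((forall p : nat, (0 < p < d)%N -> (r p <= r p.-1 * n p)%N) ->
   forall (J : forall p : nat, 'I_(r p) -> mindex n p d)
          (I : forall p : nat, 'I_(r p) -> mindex n 0 p)
          (G : ttcores R n r),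
     forward_sweep X J I G ->
     forall p : nat, (0 < p < d)%N ->
       \matrix_(a < r p) castmx (r0, erefl (r p)) (ttprod G (I p a)) = 1%:M)
  /\
  ((forall p : nat, (1 < p <= d)%N -> (r p.-1 <= n p * r p)%N) ->
   forall (I : forall p : nat, 'I_(r p) -> mindex n 0 p)
          (J : forall p : nat, 'I_(r p) -> mindex n p d)
          (G : ttcores R n r),
     reverse_sweep X I J G ->
     forall p : nat, (0 < p < d)%N ->
       \matrix_(b < r p, a < r p)
         castmx (erefl (r p), rd) (ttprod G (J p a)) b 0 = 1%:M).
Proof.
split=> _ => [J I G sweep p /andP[_ ltpd]|I J G sweep p /andP[p_gt0 ltpd]].
  apply/matrixP => a b; rewrite !mxE castmxE cast_ord_id.
  exact: forward_sweep_ttprod sweep ltpd.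
apply/matrixP => b a; rewrite !mxE castmxE cast_ord_id eq_sym.
by apply: reverse_sweep_ttprod sweep _ => //; rewrite p_gt0 ltnW.
Qed.
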